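(* For every integer $k \geq 3$, every graph $H \in \mathcal{H}_k$ is Hamiltonian but not cycle extendible.
   Context: For an integer $k \geq 1$, $G_k := K_k \vee P_{2k+1}$ is the join of a complete graph on vertices $x_1, \ldots, x_k$ with a path on $2k+1$ vertices whose vertices, in order along the path, are $u_1, u_2, \ldots, u_k, z, v_k, v_{k-1}, \ldots, v_1$ (every $x_i$ is adjacent to every path vertex and to every other $x_j$). The heavy edges of $G_k$ are $A_k = \{x_iu_i : 1 \leq i \leq k\} \cup \{x_iv_i : 1 \leq i \leq k-1\}$. Pasting a clique of order $r \geq 3$ onto an edge $ab$ means adding $r-2$ new vertices that are pairwise adjacent and each adjacent to both $a$ and $b$. $\mathcal{H}_k$ is the family of all graphs obtained from $G_k$ by pasting, onto each heavy edge in $A_k$, a clique (of any order at least $3$, possibly different for different edges), the new vertices for different heavy edges being distinct. A graph $G$ is cycle extendible if for every non-Hamiltonian cycle $C$ of $G$ there is a cycle $C'$ of $G$ with $V(C) \subset V(C')$ and $|V(C')| = |V(C)| + 1$. *)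

(* Defs.v *)
From HB Require Import structures.
From mathcomp Require Import all_boot.

Set Implicit Arguments.
Unset Strict Implicit.
Unset Printing Implicit Defensive.

Record sgraph := SGraph {
  svertex :> finType;
  sedge : rel svertex;
  sedge_sym : symmetric sedge;
  sedge_irrefl : irreflexive sedge }.

Definition isomorphic (G H : sgraph) : Prop :=
  exists2 f : G -> H, bijective f & forall x y, sedge (f x) (f y) = sedge x y.

(* A cycle is given by the sequence of its vertices, in cyclic order, so that
   V(C) is the set [set:: c].  The size condition is needed because [ucycle]
   also holds of [::] and of [:: x; y] when xy is an edge. *)
Definition graph_cycle (G : sgraph) (c : seq G) : bool :=
  (2 < size c) && ucycleb (@sedge G) c.

Definition hamiltonian_cycle (G : sgraph) (c : seq G) : bool :=
  graph_cycle c && ([set:: c] == [set: G]).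

Definition hamiltonian (G : sgraph) : Prop :=
  exists c : seq G, hamiltonian_cycle c.

Definition cycle_extendible (G : sgraph) : Prop :=
  forall c : seq G, graph_cycle c -> ~~ hamiltonian_cycle c ->
  exists c' : seq G,
    [/\ graph_cycle c', [set:: c] \subset [set:: c']
      & #|[set:: c']| = #|[set:: c]| + 1].

Section Complete.
Variable n : nat.

Definition complete_rel : rel 'I_n := fun i j => i != j.

Lemma complete_sym : symmetric complete_rel.
Proof. by move=> i j; rewrite /complete_rel eq_sym. Qed.

Lemma complete_irrefl : irreflexive complete_rel.
Proof. by move=> i; rewrite /complete_rel eqxx. Qed.

Definition complete_graph : sgraph := SGraph complete_sym complete_irrefl.
End Complete.

Section Path.
Variable n : nat.

Definition path_rel : rel 'I_n :=
  fun i j => (i.+1 == j :> nat) || (j.+1 == i :> nat).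

Lemma path_sym : symmetric path_rel.
Proof. by move=> i j; rewrite /path_rel orbC. Qed.

Lemma path_irrefl : irreflexive path_rel.
Proof. by move=> i; rewrite /path_rel orbb gtn_eqF. Qed.

Definition path_graph : sgraph := SGraph path_sym path_irrefl.
End Path.

Section Join.
Variables G H : sgraph.

Definition join_rel : rel (G + H) := fun a b =>
  match a, b with
  | inl x, inl y => sedge x y
  | inr x, inr y => sedge x y
  | _, _ => true
  end.

Lemma join_sym : symmetric join_rel.
Proof. by case=> x [] y //=; apply: sedge_sym. Qed.

Lemma join_irrefl : irreflexive join_rel.
Proof. by case=> x /=; apply: sedge_irrefl. Qed.

Definition join_graph : sgraph := SGraph join_sym join_irrefl.
End Join.

(* Simultaneous pasting of a clique of order [r (a, b)] onto every edge ab in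
   [A].  Each edge is to be listed in [A] under only one of its two
   orientations, and [r] is only used on [A].  The new vertices are tagged by
   the edge they are pasted onto. *)
Section Paste.
Variables (G : sgraph) (A : {set G * G}) (r : G * G -> nat).

Definition paste_new : finType :=
  {ab : {ab : G * G | ab \in A} & 'I_(r (val ab) - 2)}.

Definition is_end (x : G) (p : paste_new) : bool :=
  (x == (val (tag p)).1) || (x == (val (tag p)).2).

Definition paste_rel : rel (G + paste_new) := fun s t =>
  match s, t with
  | inl x, inl y => sedge x y
  | inl x, inr p => is_end x p
  | inr p, inl x => is_end x p
  | inr p, inr q => (tag p == tag q) && (p != q)
  end.

Lemma paste_sym : symmetric paste_rel.
Proof.
case=> x [] y //=; first exact: sedge_sym.
by rewrite eq_sym (eq_sym x y).
Qed.

Lemma paste_irrefl : irreflexive paste_rel.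
Proof. by case=> x /=; rewrite ?sedge_irrefl // !eqxx. Qed.

Definition paste_graph : sgraph := SGraph paste_sym paste_irrefl.
End Paste.

Definition graphG (k : nat) : sgraph :=
  join_graph (complete_graph k) (path_graph (2 * k).+1).

(* Indices are shifted to start at 0: for i < k, [vx i], [vu i] and [vv i] are
   x_(i+1), u_(i+1) and v_(i+1).  Along u_1, ..., u_k, z, v_k, ..., v_1 the
   positions 0, ..., 2k are therefore i for [vu i], k for z, and 2k - i for
   [vv i]; [inord] never overflows here. *)
Definition vx (k : nat) (i : 'I_k) : graphG k := inl i.
Definition vu (k : nat) (i : 'I_k) : graphG k := inr (inord i).
Definition vv (k : nat) (i : 'I_k) : graphG k := inr (inord (2 * k - i)).

Definition heavy_edges (k : nat) : {set graphG k * graphG k} :=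
  [set (vx i, vu i) | i : 'I_k] :|: [set (vx i, vv i) | i : 'I_k & i < k.-1].

Definition familyH (k : nat) (H : sgraph) : Prop :=
  exists2 r : graphG k * graphG k -> nat,
    (forall ab, ab \in heavy_edges k -> 3 <= r ab)
    & isomorphic H (paste_graph (heavy_edges k) r).

(* Main.v *)
Require Import Defs.
From mathcomp Require Import all_boot zify.

(* A cycle of H that meets every pasted clique must traverse each of them
   between its two attaching vertices, so it behaves like a cycle of [G_k]
   through all heavy edges.  Such a cycle contains the segments u_i x_i v_i
   (i < k) and x_k u_k; the segments can be chained through the edges u_i u_(i+1)
   and v_i v_(i+1) in a zigzag x_1, x_2, ..., x_(k-1) ending at u_(k-1) or at
   v_(k-1), as we like.  Ending at v_(k-1) and closing with v_k, z, u_k, x_k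
   gives a Hamiltonian cycle; ending at u_(k-1) and closing with u_k, x_k gives
   a cycle C missing exactly z and v_k.

   C has no extension.  A cycle missing only z has to use x_k v_k, which
   saturates x_k; then u_1 u_2 and v_1 v_2 are forced and close up a cycle
   inside the first two levels.  A cycle missing only v_k has to use z u_k and
   z x_k, which closes up with the clique on x_k u_k. *)

Set Implicit Arguments.
Unset Strict Implicit.
Unset Printing Implicit Defensive.

(** * Paths that span a prescribed vertex set *)

Section SpanningPaths.
Variables (T : finType) (e : rel T).
Hypothesis e_sym : symmetric e.
Implicit Types (S : {set T}) (a b c d : T).

(** Hamiltonian paths of the subgraph induced on [S]. With the vertex set explicit, assembling long
    paths comes down to set identities and disjointness. *)
Definition spans S a b := exists s : seq T,
  [/\ path e a s, last a s = b, uniq (a :: s) & a :: s =i S].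

Lemma spans_sym S a b : spans S a b -> spans S b a.
Proof.
case=> s [p_s <- u_s sS]; exists (rev (belast a s)).
have rs : last a s :: rev (belast a s) = rev (a :: s).
  by rewrite [in RHS]lastI rev_rcons.
split.
- by rewrite rev_path (eq_path (e' := e)) // => x y; rewrite e_sym.
- by case: s {p_s u_s sS rs} => [|x s] //=; rewrite rev_cons last_rcons.
- by rewrite rs rev_uniq.
- by move=> x; rewrite rs mem_rev sS.
Qed.

Lemma spans1 a : spans [set a] a a.
Proof. by exists [::]; split=> // x; rewrite !inE. Qed.

Lemma spans_cat S S' a b c d : spans S a b -> e b c -> spans S' c d ->
  [disjoint S & S'] -> spans (S :|: S') a d.
Proof.
case=> s [p_s l_s u_s sS] e_bc [t [p_t l_t u_t tS]] dSS.
exists (s ++ c :: t); split.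
- by rewrite cat_path p_s l_s /= e_bc.
- by rewrite last_cat.
- rewrite -cat_cons cat_uniq u_s u_t andbT; apply/hasPn=> x.
  rewrite tS => xS'; rewrite /= sS; apply/negP=> xS.
  by rewrite (disjointFl dSS) in xS.
- by move=> x; rewrite -cat_cons mem_cat sS tS inE.
Qed.

(** The shared vertex [b] ends the first path and starts the second; the concatenation keeps only
    its first copy. *)
Lemma spans_glue S S' a b c : spans S a b -> spans S' b c ->
  S :&: S' = [set b] -> spans (S :|: S') a c.
Proof.
case=> s [p_s l_s u_s sS] [t [p_t l_t u_t tS]] SS.
have bS : b \in S by rewrite -sS -l_s mem_last.
exists (s ++ t); split.
- by rewrite cat_path p_s l_s.
- by rewrite last_cat l_s.
- rewrite -cat_cons cat_uniq u_s; move: (u_t) => /= /andP[b_t ->].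
  rewrite andbT; apply/hasPn=> x xt; apply: contra b_t => xs.
  suff /set1P <- : x \in [set b] by [].
  by rewrite -SS inE -sS xs -tS inE xt orbT.
- move=> x; rewrite -cat_cons mem_cat sS inE -tS inE.
  by case: eqP => [->|//]; rewrite bS.
Qed.

(** Any duplicate-free listing of a clique is a path, so the remaining vertices go between [a] and
    [b] in arbitrary order. *)
Lemma spans_clique S a b : {in S &, forall x y, x != y -> e x y} ->
  a \in S -> b \in S -> a != b -> spans S a b.
Proof.
move=> clS aS bS ab; pose s := enum (S :\ a :\ b).
have mem_s x : x \in s = [&& x != b, x != a & x \in S].
  by rewrite mem_enum !inE.
have u_s : uniq (a :: rcons s b).
  by rewrite /= rcons_uniq enum_uniq mem_rcons inE !mem_s !eqxx (negPf ab).
have sS : a :: rcons s b =i S.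
  move=> x; rewrite inE mem_rcons inE mem_s.
  by case: eqP => [->|_]; [rewrite aS|case: eqP => [->|_]; rewrite ?bS].
exists (rcons s b); split=> //; last by rewrite last_rcons.
have /= := @pairwise_sorted _ e (a :: rcons s b); apply.
have u_s' : pairwise [rel x y | x != y] (a :: rcons s b) by rewrite -uniq_pairwise.
apply: (sub_in_pairwise (P := [in S])) u_s' => //.
by apply/allP=> x; rewrite sS.
Qed.
End SpanningPaths.

Lemma spans_cycle (G : sgraph) (S : {set G}) a b :
  spans (@sedge G) S a b -> sedge b a -> 2 < #|S| ->
  exists c : seq G, graph_cycle c /\ [set:: c] = S.
Proof.
case=> s [p_s <- u_s sS] e_ba S_gt2; exists (a :: s); split; last first.
  by apply/setP=> x; rewrite inE sS.
rewrite /graph_cycle /ucycleb u_s (cycle_path a) /= e_ba p_s !andbT.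
by move: S_gt2; rewrite -(eq_card sS) (card_uniqP u_s) /= => ->.
Qed.

(** * Neighbours along a cycle *)

Section CycleNeighbours.
Variables (T : finType) (e : rel T) (c : seq T).
Hypotheses (e_sym : symmetric e) (cyc_c : cycle e c) (uniq_c : uniq c).
Implicit Types (x y a b : T) (S : {set T}).

(** The test [x \in c] is needed because [next] and [prev] return [x] itself when [x] is off the
    cycle. *)
Definition cyc_adj x y := (x \in c) && ((y == next c x) || (y == prev c x)).

Lemma cyc_adj_edge x y : cyc_adj x y -> e x y.
Proof.
case/andP=> xc /orP[] /eqP ->; first exact: next_cycle.
by rewrite e_sym; apply: prev_cycle.
Qed.

Lemma cyc_adj_mem x y : cyc_adj x y -> y \in c.
Proof. by case/andP=> xc /orP[] /eqP ->; rewrite (mem_next, mem_prev). Qed.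

Lemma cyc_adj_sym x y : cyc_adj x y = cyc_adj y x.
Proof.
suff imp u v : cyc_adj u v -> cyc_adj v u by apply/idP/idP; apply: imp.
move=> uv; rewrite /cyc_adj (cyc_adj_mem uv).
by case/andP: uv => uc /orP[] /eqP ->; rewrite (next_prev, prev_next) ?eqxx ?orbT.
Qed.

(** Saturation: [next] and [prev] are the only neighbours, so two known distinct ones exclude every
    further cycle edge at [x]. *)
Lemma cyc_adj_inv x a b y : cyc_adj x a -> cyc_adj x b -> a != b ->
  cyc_adj x y -> y = a \/ y = b.
Proof.
case/andP=> _ /orP[] /eqP -> /andP[_ /orP[] /eqP ->]; rewrite ?eqxx // => _;
  by case/andP=> _ /orP[] /eqP ->; auto.
Qed.

(** Iterating [next] from [x] visits the whole cycle and never leaves [S]. Contradictions arise from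
    a closed [S] that omits some cycle vertex. *)
Lemma cyc_adj_closed S x : x \in S -> x \in c ->
  (forall y z, y \in S -> cyc_adj y z -> z \in S) -> {subset c <= S}.
Proof.
move=> xS xc clS y; rewrite -(fconnect_cycle (cycle_next uniq_c) xc).
case/iter_findex/esym=> ->; elim: (findex _ _ _) => //= n IHn.
have nc : iter n (next c) x \in c by elim: n {IHn} => //= n IHn; rewrite mem_next.
by apply: (clS _ _ IHn); rewrite /cyc_adj nc eqxx.
Qed.

Lemma cyc_adj_rot x s i : rot i c = x :: s ->
  cyc_adj x (head x s) /\ cyc_adj x (last x s).
Proof.
move=> rc; have xc : x \in c by rewrite -(mem_rot i) rc mem_head.
rewrite /cyc_adj xc -(next_rot i uniq_c) -(prev_rot i uniq_c) rc.
have: uniq (x :: s) by rewrite -rc rot_uniq.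
case/andP=> xs _; rewrite prev_nth next_nth mem_head (memNindex xs) /= eqxx nth0.
by rewrite -[nth _ _ _]/(nth x (x :: s) (size (x :: s)).-1) nth_last /= !eqxx orbT.
Qed.

Lemma cyc_adj2 x : 2 < size c -> x \in c ->
  exists a b, [/\ cyc_adj x a, cyc_adj x b & a != b].
Proof.
move=> sz /rot_to[i s rc]; have [ax xb] := cyc_adj_rot rc.
exists (head x s), (last x s); split=> //.
have: uniq (x :: s) by rewrite -rc rot_uniq.
have: 2 < size (x :: s) by rewrite -rc size_rot.
case: s {rc ax xb} => [|y [|z s]] //= _ /and3P[_ ys _].
by apply: contraNneq ys => ->; apply: mem_last.
Qed.

(* Deleting [a] and [b] from the cycle leaves two arcs, each of them inside [N]
   or disjoint from it. *)
Lemma cyc_adj_separator (N : {set T}) a b p w :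
  (forall x y, x \in N -> e x y -> [|| y \in N, y == a | y == b]) ->
  a \in c -> b \in c -> a != b -> p \in c -> w \in c -> p \in N :\ a :\ b ->
  w \notin b |: (a |: N) ->
  (exists2 q, q \in N & cyc_adj a q) /\
  (exists2 q, q \notin b |: (a |: N) & cyc_adj a q).
Proof.
move=> sepN /rot_to[i s rc] bc ab pc wc; rewrite !inE !negb_or.
move=> /and3P[pb pa pN] /and3P[wb wa wN].
have [a_head a_last] := cyc_adj_rot rc.
have mem_s x : x != a -> x \in c -> x \in s.
  by move=> xa; rewrite -(mem_rot i) rc inE (negPf xa).
have: uniq (a :: s) by rewrite -rc rot_uniq.
have: cycle e (a :: s) by rewrite -rc rot_cycle.
have := mem_s _ wa wc; have := mem_s _ pa pc.
have bs : b \in s by rewrite mem_s // eq_sym.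
move: {mem_s} a_head a_last; case/splitPr: s / bs {rc} => s1 s2.
(* The cycle now reads [a], [s1], [b], [s2]. By [sepN] and the symmetry of [e], membership in [N]
   cannot change along a path avoiding [a] and [b]. *)
have arc x t : path e x t -> a \notin x :: t -> b \notin x :: t ->
    {in x :: t, forall y, (y \in N) = (x \in N)}.
  elim: t x => [|z t IHt] x /=; first by move=> _ _ _ y; rewrite inE => /eqP->.
  case/andP=> xz pt; rewrite inE negb_or => /andP[ax a_t].
  rewrite [b \in _]inE negb_or => /andP[bx b_t] y.
  rewrite inE => /predU1P[-> //|yt].
  rewrite (IHt _ pt a_t b_t y yt).
  have [za zb] : z != a /\ z != b.
    move: a_t b_t; rewrite !inE !negb_or ![z == _]eq_sym.
    by case/andP=> -> _ /andP[-> _].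
  apply/idP/idP=> [zN|xN].
    have /or3P[//|xa|xb] := sepN z x zN (etrans (e_sym z x) xz).
      by rewrite eq_sym xa in ax.
    by rewrite eq_sym xb in bx.
  by have := sepN x z xN xz; rewrite (negPf za) (negPf zb) !orbF.
rewrite (cycle_path a) /= cat_path !mem_cat !inE (negPf pb) (negPf wb) /=.
rewrite cat_uniq /= !negb_or last_cat /=.
move=> a_head a_last p12 w12 /and4P[_ p_s1 _ p_s2].
case/and4P=> /and3P[a_s1 _ a_s2] _ /andP[b_s1 _] /andP[b_s2 _].
(* If an arc is empty, [p] and [w] both lie on the other one, where membership in [N] is constant:
   impossible. *)
case: s1 a_head p12 w12 p_s1 a_s1 b_s1 => [|y t1] /= a_y p12 w12 p_s1 a_s1 b_s1.
  case: s2 p12 w12 p_s2 a_s2 b_s2 {a_last} => [|z t2] //= p12 w12 /andP[_ ?] ? ?.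
  by move: wN; rewrite (arc z t2) // -(arc z t2 _ _ _ p) // pN.
have arc1 := arc y t1 (proj2 (andP p_s1)) a_s1 b_s1.
case: s2 p12 w12 p_s2 a_s2 b_s2 a_last => [|z t2] /= p12 w12 p_s2 a_s2 b_s2 a_z.
  by move: p12 w12 wN; rewrite !orbF => /arc1 p1 /arc1 ->; rewrite -p1 pN.
have arc2 := arc z t2 (proj2 (andP p_s2)) a_s2 b_s2.
have zN : (last z t2 \in N) = (z \in N) by apply: arc2; apply: mem_last.
have outN q : q \in y :: t1 \/ q \in z :: t2 -> q \notin N -> q \notin b |: (a |: N).
  move=> qs qN; rewrite !inE !negb_or qN andbT.
  by case: qs => qs; apply/andP; split;
    apply: contraTneq qs => ->; rewrite ?a_s1 ?b_s1 ?a_s2 ?b_s2.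
(* Since [p] is in [N] and [w] is not, the arcs lie on different sides. The neighbours of [a] are
   the start [y] of the first arc and the end of the second. *)
have yz : (y \in N) != (z \in N).
  case/orP: p12 => [/arc1|/arc2] p12; case/orP: w12 => [/arc1|/arc2] w12;
    by move: pN wN; rewrite p12 w12; do 2 case: (_ \in N).
have y1 := mem_head y t1; have z2 := mem_last z t2.
move: yz; case: (boolP (y \in N)) => yN; case: (boolP (z \in N)) => zN' //= _.
  by split; [exists y | exists (last z t2) => //; apply: outN; [right | rewrite zN]].
by split; [exists (last z t2); rewrite ?zN | exists y => //; apply: outN; [left | ]].
Qed.

End CycleNeighbours.

(** * Pasted cliques and the cycles through them *)

Section PasteFacts.
Variables (G : sgraph) (A : {set G * G}) (r : G * G -> nat).
Let P := paste_graph A r.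
Implicit Types (a b : G) (x y : P).

Lemma is_endE (q : paste_new A r) ab d : val (tag q) = ab ->
  is_end d q = (d == ab.1) || (d == ab.2).
Proof. by move=> <-. Qed.

Definition pnew ab : {set P} :=
  [set x : P | if x is inr q then val (tag q) == ab else false].

Definition pclique a b : {set P} :=
  (inl b : P) |: ((inl a : P) |: pnew (a, b)).

(** The ends [a] and [b] separate the new vertices from the rest of the graph, as
    [cyc_adj_separator] requires. *)
Lemma pnew_edge a b x y : x \in pnew (a, b) -> sedge x y ->
  [|| y \in pnew (a, b), y == inl a | y == inl b].
Proof.
case: x => [x|p]; rewrite inE // => /eqP tp.
case: y => [y|q]; rewrite /= inE; first by rewrite /is_end tp.
by case/andP=> /eqP <- _; rewrite tp eqxx.
Qed.

Lemma pnew_exists ab : ab \in A -> 2 < r ab -> exists x, x \in pnew ab.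
Proof.
move=> abA r3; have r2 : 0 < r ab - 2 by rewrite subn_gt0.
by exists (inr (Tagged (fun ab : {ab | ab \in A} => 'I_(r (val ab) - 2))
  (Ordinal r2 : 'I_(r (val (Sub ab abA : {ab | ab \in A})) - 2)))); rewrite inE /=.
Qed.

Lemma pclique_clique a b : sedge a b ->
  {in pclique a b &, forall x y, x != y -> sedge x y}.
Proof.
move=> ab; have ba : sedge b a by rewrite sedge_sym.
move=> x y; rewrite !inE => /or3P[/eqP->|/eqP->|xN] /or3P[/eqP->|/eqP->|yN];
  rewrite ?eqxx //= => xy.
- by case: y yN {xy} => [|q] // /eqP tq; rewrite /= (is_endE _ tq) eqxx orbT.
- by case: y yN {xy} => [|q] // /eqP tq; rewrite /= (is_endE _ tq) eqxx.
- by case: x xN {xy} => [|q] // /eqP tq; rewrite /= (is_endE _ tq) eqxx orbT.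
- by case: x xN {xy} => [|q] // /eqP tq; rewrite /= (is_endE _ tq) eqxx.
case: x y xN yN xy => [x|p] [y|q] //= /eqP tp /eqP tq pq.
apply/andP; split; last by apply: contraNneq pq => ->.
by apply/eqP/val_inj; apply: etrans tp (esym tq).
Qed.

(** A cycle that also visits a vertex [w] outside the clique crosses the clique from one end to the
    other: each end spends one cycle edge on the new vertices and one outside the clique. *)
Lemma paste_cycle_new (c : seq P) a b w : graph_cycle c ->
  (a, b) \in A -> 2 < r (a, b) -> a != b ->
  inl a \in c -> inl b \in c -> {subset pnew (a, b) <= c} ->
  w \in c -> w \notin pclique a b ->
  forall d, d \in [:: a; b] ->
  (exists2 q, q \in pnew (a, b) & cyc_adj c (inl d) q) /\
  (exists2 q, q \notin pclique a b & cyc_adj c (inl d) q).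
Proof.
case/andP=> _ /andP[cyc_c uniq_c] abA r3 ab ac bc Nc wc wK d.
have [p pN] := pnew_exists abA r3.
(* The separator lemma speaks of its first cut vertex only, so it is used twice, the second time
   with [a] and [b] exchanged. *)
have KC : pclique a b = (inl a : P) |: ((inl b : P) |: pnew (a, b)).
  by apply/setP=> x; rewrite !inE orbCA.
have ab' : (inl a : P) != inl b by apply: contraNneq ab => -[->].
have pD d' : p != inl d' by apply: contraTneq pN => ->; rewrite inE.
have pab d1 d2 : p \in pnew (a, b) :\ inl d1 :\ inl d2.
  by rewrite !in_setD1 !pD.
have sep := @cyc_adj_separator P (@sedge P) c (@sedge_sym P) cyc_c uniq_c (pnew (a, b)).
rewrite !inE => /orP[] /eqP ->.
  by apply: (sep _ _ p w) => //; [apply: pnew_edge | apply: Nc].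
rewrite KC in wK *; apply: (sep _ _ p w) => //; last by apply: Nc.
  by move=> x y xN xy; have := pnew_edge xN xy; rewrite [(_ == _) || _]orbC.
by rewrite eq_sym.
Qed.
End PasteFacts.

(** * Coordinates and levels in the pasted graph, with k = [m.+1] *)

Section FamilyH.
Variables (m : nat) (r : graphG m.+1 * graphG m.+1 -> nat).
Hypothesis r_ge3 : forall ab, ab \in heavy_edges m.+1 -> 3 <= r ab.

(* [ge i true] and [ge i false] are [vu i] and [vv i] for [i <= m], while
   [ge m.+1 true = ge m.+1 false] is z. *)
Definition gx i : graphG m.+1 := inl (inord i).
Definition ge i (b : bool) : graphG m.+1 :=
  inr (inord (if b then i else 2 * m.+1 - i)).

(* The index of a vertex of G_k counted from 0, with level [m.+1] for z. *)
Definition levG (g : graphG m.+1) : nat :=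
  match g with inl i => i | inr j => minn j (2 * m.+1 - j) end.

Lemma gx_eq i j : i <= m -> j <= m -> (gx i == gx j) = (i == j).
Proof.
move=> im jm; apply/eqP/eqP => [[/(congr1 (@nat_of_ord _))]|->//].
by rewrite !inordK.
Qed.

Lemma ge_eq i b j b' : i <= m.+1 -> j <= m.+1 ->
  (ge i b == ge j b') = (i == j) && ((b == b') || (i == m.+1)).
Proof.
move=> im jm; apply/eqP/idP => [[/(congr1 (@nat_of_ord _))]|].
  rewrite !inordK; case: b; case: b'; lia.
rewrite /ge => ij; congr (inr (inord _)); move: ij; case: b; case: b' => /=; lia.
Qed.

Lemma levG_gx i : i <= m -> levG (gx i) = i.
Proof. by move=> im; rewrite /= inordK. Qed.

Lemma levG_ge i b : i <= m.+1 -> levG (ge i b) = i.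
Proof. by move=> im; rewrite /= inordK; case: b; lia. Qed.

Lemma ge_edge i b : i <= m -> sedge (ge i b) (ge i.+1 b).
Proof. by move=> im; rewrite /= /path_rel !inordK; case: b; lia. Qed.

(** Path edges change the level by one, and the two sides meet only at z. *)
Lemma ge_edge_inv i b j b' : i <= m.+1 -> j <= m.+1 -> sedge (ge i b) (ge j b') ->
  ((j == i.+1) || (i == j.+1)) && [|| b == b', i == m.+1 | j == m.+1].
Proof. by move=> im jm; rewrite /= /path_rel !inordK; case: b; case: b'; lia. Qed.

Lemma graphG_vertex (g : graphG m.+1) :
  (exists2 i, i <= m & g = gx i) \/ (exists i b, i <= m.+1 /\ g = ge i b).
Proof.
case: g => [i|j]; [left|right].
  by exists i; rewrite ?/gx ?inord_val // -ltnS.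
have jm := ltn_ord j; case: (leqP j m.+1) => jm'.
  by exists j, true; rewrite /ge inord_val.
exists (2 * m.+1 - j), false; split; first lia.
by rewrite /ge subKn ?inord_val //; lia.
Qed.

(** With [b] read as 0 or 1, the bound allows [i <= m] on the u side but only [i < m] on the v side:
    x_k v_k is not heavy. *)
Lemma heavyP ab : reflect (exists i (b : bool), i < m + b /\ ab = (gx i, ge i b))
  (ab \in heavy_edges m.+1).
Proof.
have vxE (i : 'I_m.+1) : vx i = gx i by rewrite /vx /gx inord_val.
apply: (iffP idP) => [|[i [b [im ->]]]].
  rewrite inE => /orP[] /imsetP[i im ->]; rewrite vxE.
    by exists i, true; rewrite addn1.
  by exists i, false; rewrite addn0; move: im; rewrite inE.
have im1 : i < m.+1 by case: b im; lia.
have vxI : gx i = vx (Ordinal im1) by rewrite vxE.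
rewrite inE vxI; case: b im => im; apply/orP; [left|right].
  by apply/imsetP; exists (Ordinal im1).
by apply/imsetP; exists (Ordinal im1); rewrite // inE /=; lia.
Qed.

Let P := paste_graph (heavy_edges m.+1) r.
Definition px i : P := inl (gx i).
Definition pe i b : P := inl (ge i b).
Definition pn i b : {set P} := pnew (heavy_edges m.+1) r (gx i, ge i b).
Definition pK i b : {set P} := pclique (heavy_edges m.+1) r (gx i) (ge i b).

(** A new vertex takes the level of the x end of its heavy edge, which is also that of the other
    end. *)
Definition lev (x : P) : nat :=
  match x with inl g => levG g | inr p => levG (val (tag p)).1 end.

(** Case analysis by coordinates; it turns equalities of vertex sets into arithmetic on indices. The
    vertex z occurs under both values of [b]. *)
Variant pvertex_spec : P -> Prop :=
  | PX i of i <= m : pvertex_spec (px i)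
  | PE i b of i <= m.+1 : pvertex_spec (pe i b)
  | PN i (b : bool) x of i < m + b & x \in pn i b : pvertex_spec x.

Lemma pvertexP x : pvertex_spec x.
Proof.
case: x => [g|p].
  by case: (graphG_vertex g) => [[i im ->]|[i [b [im ->]]]]; constructor.
have /heavyP[i [b [im ep]]] := valP (tag p).
by apply: (PN im); rewrite inE; apply/eqP.
Qed.

Lemma lev_px i : i <= m -> lev (px i) = i. Proof. exact: levG_gx. Qed.
Lemma lev_pe i b : i <= m.+1 -> lev (pe i b) = i. Proof. exact: levG_ge. Qed.

Lemma lt_heavy i (b : bool) : i < m + b -> i <= m.
Proof. by case: b; lia. Qed.

Lemma lev_pn i b x : i <= m -> x \in pn i b -> lev x = i.
Proof.
case: x => [x|p]; rewrite inE //= => im /eqP ep.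
by rewrite [val _]ep levG_gx.
Qed.

Lemma px_pn i j b : (px i \in pn j b) = false. Proof. by rewrite inE. Qed.
Lemma pe_pn i b' j b : (pe i b' \in pn j b) = false. Proof. by rewrite inE. Qed.

Lemma px_pe i j b : (px i == pe j b) = false. Proof. by []. Qed.
Lemma pn_inl i b x g : x \in pn i b -> (x == inl g) = false.
Proof. by apply: contraTF => /eqP->; rewrite inE. Qed.

Lemma pn_pn i b j b' x : i <= m -> j <= m -> x \in pn i b ->
  (x \in pn j b') = (i == j) && (b == b').
Proof.
case: x => [x|p]; rewrite !inE // => im jm /eqP ep; rewrite [val _]ep.
transitivity ((gx i == gx j) && (ge i b == ge j b')); first exact: xpair_eqE.

rewrite gx_eq // ge_eq ?leqW // [i == m.+1]ltn_eqF ?ltnS // orbF.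
by rewrite andbA andbb.
Qed.

Lemma inl_paste_eq (g g' : graphG m.+1) : ((inl g : P) == inl g') = (g == g').
Proof. exact: (inj_eq (@inl_inj _ _)). Qed.

Lemma px_pK i j b : i <= m -> j <= m -> (px i \in pK j b) = (i == j).
Proof.
by move=> im jm; rewrite 2!in_setU1 px_pn orbF !inl_paste_eq gx_eq.
Qed.

Lemma pe_pK i b j b' : i <= m.+1 -> j <= m ->
  (pe i b \in pK j b') = (i == j) && (b == b').
Proof.
move=> im jm; rewrite 2!in_setU1 pe_pn !inl_paste_eq !orbF ge_eq //; last lia.
by case: eqP => // ->; rewrite [j == m.+1]ltn_eqF ?ltnS // orbF.
Qed.

Lemma pn_pK i b j b' x : i <= m -> j <= m -> x \in pn i b ->
  (x \in pK j b') = (i == j) && (b == b').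
Proof.
move=> im jm xN; rewrite -(pn_pn _ im jm xN) 2!in_setU1.
by rewrite !(pn_inl _ xN).
Qed.

Lemma px_edge_pe i j b : sedge (px i) (pe j b). Proof. by []. Qed.

Lemma pe_edge i b : i <= m -> sedge (pe i b) (pe i.+1 b).
Proof. exact: ge_edge. Qed.

Lemma pe_neq i b j b' : i <= m.+1 -> j <= m.+1 ->
  ~~ ((i == j) && ((b == b') || (i == m.+1))) -> pe i b != pe j b'.
Proof. by move=> im jm; rewrite inl_paste_eq ge_eq. Qed.

Lemma spans_pK i b : i <= m -> spans (@sedge P) (pK i b) (pe i b) (px i).
Proof.
move=> im; apply: spans_clique; rewrite ?pe_pK ?px_pK ?eqxx ?leqW //.
exact: pclique_clique.
Qed.

(** The level is the union of two cliques meeting only in x_(i+1): cross one towards that vertex and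
    the other away from it. *)
Lemma spans_level i b : i < m ->
  spans (@sedge P) [set x | lev x == i] (pe i b) (pe i (~~ b)).
Proof.
move=> im; have im' := ltnW im.
have eqS : [set x | lev x == i] = pK i b :|: pK i (~~ b).
  apply/setP=> x; rewrite in_setU in_set.
  case: (pvertexP x) => {x} [j jm|j b' jm|j b' x jm xN].
  - by rewrite !px_pK // lev_px // orbb.
  - by rewrite !pe_pK // lev_pe //; case: eqP; case: (b); case: (b').
  - have jm' := lt_heavy jm.
    by rewrite !(pn_pK _ _ _ xN) // (lev_pn _ xN) //; case: eqP; case: (b); case: (b').
rewrite eqS; apply: (spans_glue (b := px i)).
- exact: spans_pK.
- by apply: spans_sym; [apply: sedge_sym | apply: spans_pK].
apply/setP=> x; rewrite in_setI in_set1.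
case: (pvertexP x) => {x} [j jm|j b' jm|j b' x jm xN].
- by rewrite !px_pK // andbb inl_paste_eq gx_eq.
- by rewrite !pe_pK //; case: eqP; case: (b); case: (b').
- have jm' := lt_heavy jm; rewrite !(pn_pK _ _ _ xN) //.
  rewrite (pn_inl _ xN).
  by case: eqP; case: (b); case: (b').
Qed.

(** Each level switches sides, so the final side can be prescribed and the starting side [b0] is
    determined by parity. *)
Lemma zigzag j b : j < m ->
  exists b0, spans (@sedge P) [set x | lev x <= j] (pe 0 b0) (pe j b).
Proof.
elim: j b => [|j IHj] b jm.
  exists (~~ b).
  have -> : [set x | lev x <= 0] = [set x | lev x == 0].
    by apply/setP=> x; rewrite !inE leqn0.
  by have := @spans_level 0 (~~ b) jm; rewrite negbK.
have [b0 zj] := IHj (~~ b) (ltnW jm); exists b0.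
have -> : [set x | lev x <= j.+1] = [set x | lev x <= j] :|: [set x | lev x == j.+1].
  by apply/setP=> x; rewrite !inE; lia.
have := @spans_level j.+1 (~~ b) jm; rewrite negbK => sj; apply: (spans_cat zj _ sj).
  by apply: pe_edge; lia.
by apply/pred0P=> x; rewrite /= !inE; lia.
Qed.

(** * Construction of the Hamiltonian cycle and of the cycle missing v_k and z *)

Hypothesis m_ge2 : 1 < m.

Lemma lev_pK i b x : i <= m -> x \in pK i b -> lev x = i.
Proof.
move=> im; rewrite 2!in_setU1 => /or3P[/eqP->|/eqP->|xN].
- by rewrite lev_pe // leqW.
- exact: lev_px.
- exact: lev_pn xN.
Qed.

Lemma disjoint_low_pK b : [disjoint [set x | lev x <= m.-1] & pK m b].
Proof.
apply/pred0P=> x; rewrite /= in_set; apply/negP=> /andP[lx xK].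
by move: lx; rewrite (lev_pK _ xK) //; lia.
Qed.

Lemma sedge_last_low b : sedge (pe m.-1 b) (pe m b).
Proof. by have := @pe_edge m.-1 b; rewrite prednK; [apply; lia | lia]. Qed.

Lemma card_gt2_level0 (S : {set P}) :
  px 0 \in S -> (forall b, pe 0 b \in S) -> 2 < #|S|.
Proof.
move=> xS eS; apply/card_gt2P; exists (px 0), (pe 0 true), (pe 0 false).
by split; split=> //; apply: pe_neq.
Qed.

Lemma paste_hamiltonian : hamiltonian P.
Proof.
have m0 : m.-1 < m by lia.
(* The side [false] makes the zigzag end at v_(k-1). *)
have [b0 zz] := zigzag false m0.
have e1 := sedge_last_low false.
have e2 : sedge (pe m false) (pe m.+1 false) by apply: pe_edge.
have e3 : sedge (pe m.+1 false) (pe m true).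
  (* The two names of z let the path pass from the v side to the u side. *)
  have zE : pe m.+1 false = pe m.+1 true by apply/eqP; rewrite inl_paste_eq ge_eq // eqxx orbT.
  by rewrite sedge_sym zE; apply: pe_edge.
have K := @spans_pK m true (leqnn m).
have := spans_cat (spans_cat (spans_cat zz e1 (spans1 _ _) _) e2 (spans1 _ _) _) e3 K _.
set S := _ :|: pK _ _.
have -> : S = setT.
  apply/setP=> x; rewrite /S 3!in_setU 2!in_set1 in_set in_setT.
  case: (pvertexP x) => {x} [j jm|j b jm|j b x jm xN].
  - rewrite px_pK // lev_px // !px_pe; lia.
  - by rewrite pe_pK // lev_pe // !inl_paste_eq !ge_eq //; lia.
  - have jm' := lt_heavy jm; rewrite (pn_pK _ _ _ xN) // (lev_pn _ xN) // !(pn_inl _ xN).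
    by case: b jm xN; lia.
case/(_ _ _ _)/spans_cycle => [||| | |c [cc cS]].
- rewrite disjoint_sym disjoints1 in_set lev_pe //; lia.
- rewrite disjoint_sym disjoints1 in_setU in_set in_set1 lev_pe // inl_paste_eq ge_eq //; lia.
- apply/pred0P=> x; rewrite /= 2!in_setU in_set 2!in_set1; apply/negP.
  case/andP=> /orP[/orP[lx xK|/eqP->]|/eqP->]; rewrite ?pe_pK ?eqxx //.
    by move: lx; rewrite (lev_pK _ xK) //; lia.
  by rewrite gtn_eqF.
(* The closing edge starts at x_k, which is adjacent to the first vertex whatever [b0] is. *)
- exact: px_edge_pe.
- by apply: card_gt2_level0 => *; rewrite in_setT.
by exists c; rewrite /hamiltonian_cycle cc cS eqxx.
Qed.

Lemma paste_cycle_missing_v_z :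
  exists c : seq P, graph_cycle c /\ [set:: c] = ~: [set pe m false; pe m.+1 true].
Proof.
have m0 : m.-1 < m by lia.
(* Now the zigzag ends at u_(k-1), so the path continues directly into the clique on x_k u_k. *)
have [b0 zz] := zigzag true m0.
have := spans_cat zz (sedge_last_low true) (@spans_pK m true (leqnn m)) (disjoint_low_pK _).
set S := _ :|: _.
have -> : S = ~: [set pe m false; pe m.+1 true].
  apply/setP=> x; rewrite /S in_setU in_set in_setC in_set2.
  case: (pvertexP x) => {x} [j jm|j b jm|j b x jm xN].
  - rewrite px_pK // lev_px // !px_pe; lia.
  - by rewrite pe_pK // lev_pe // !inl_paste_eq !ge_eq //; case: b; lia.
  - have jm' := lt_heavy jm; rewrite (pn_pK _ _ _ xN) // (lev_pn _ xN) // !(pn_inl _ xN).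
    by case: b jm xN; lia.
move/spans_cycle; apply; first exact: px_edge_pe.
apply: card_gt2_level0 => *; rewrite in_setC in_set2 ?px_pe //.
by rewrite !inl_paste_eq !ge_eq //; lia.
Qed.

(** * Cycles missing exactly one vertex, either z or v_k *)

Section MissingOne.
Variables (c : seq P) (bad : P).
Hypotheses (cc : graph_cycle c) (mem_c : forall x, (x \in c) = (x != bad)).
Hypothesis bad_z_or_v : bad = pe m false \/ bad = pe m.+1 true.

Let adj := cyc_adj c.

Let uniq_c : uniq c. Proof. by case/andP: cc => _ /andP[]. Qed.

Lemma adj_edge x y : adj x y -> sedge x y.
Proof. by case/andP: cc => _ /andP[cyc_c _]; apply: cyc_adj_edge; first exact: sedge_sym. Qed.

Lemma adj_sym x y : adj x y = adj y x. Proof. exact: cyc_adj_sym. Qed.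

Lemma adj_neq_bad x y : adj x y -> y != bad.
Proof. by move/cyc_adj_mem; rewrite mem_c. Qed.

Lemma px_c i : px i \in c.
Proof. by rewrite mem_c; case: bad_z_or_v => ->. Qed.

Lemma pn_c i b x : x \in pn i b -> x \in c.
Proof. by rewrite mem_c => xN; case: bad_z_or_v => ->; rewrite (pn_inl _ xN). Qed.

Lemma pe_c i (b : bool) : i < m + b -> pe i b \in c.
Proof.
move=> im; have im' := lt_heavy im; rewrite mem_c.
by case: bad_z_or_v => ->; rewrite inl_paste_eq ge_eq //; case: b im; lia.
Qed.

(** Neither z nor v_k lies in a clique on a heavy edge, so the cycle contains all these cliques and
    [paste_cycle_new] applies to each. *)
Lemma heavy_adj i (b : bool) d : i < m + b -> d \in [:: gx i; ge i b] ->
  (exists2 q, q \in pn i b & adj (inl d) q) /\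
  (exists2 q, q \notin pK i b & adj (inl d) q).
Proof.
move=> im; have im' := lt_heavy im.
have hA : (gx i, ge i b) \in heavy_edges m.+1 by apply/heavyP; exists i, b.
(* The vertex [px (i == 0)] is x_2 if [i] is 0 and x_1 otherwise, hence outside the clique. *)
apply: (@paste_cycle_new _ _ _ c _ _ (px (i == 0))) => //; first exact: r_ge3.
- exact: px_c.
- exact: pe_c.
- by move=> x; apply: pn_c.
- exact: px_c.
by rewrite px_pK //; case: i {im im' hA} => //=; lia.
Qed.

(** For [i < m] the vertex lies on two heavy edges, whose cliques take up both of its cycle
    edges. *)
Lemma adj_px i y : i < m -> adj (px i) y -> y \in pn i true \/ y \in pn i false.
Proof.
move=> im xy; have im' := ltnW im.
have [[q qN xq] _] := @heavy_adj i true _ (ltn_addr _ im) (mem_head _ _).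
have [[q' qN' xq'] _] := @heavy_adj i false _ (ltn_addr _ im) (mem_head _ _).
have qq : q != q'.
  by apply: contraTneq qN => ->; rewrite (pn_pn _ _ _ qN') // andbF.
by case: (cyc_adj_inv xq xq' qq xy) => ->; auto.
Qed.

(** Every x_i except x_k is saturated by its cliques, so besides x_k only the vertex's own clique
    and its path neighbours remain. *)
Lemma adj_pe i b y : i <= m.+1 -> adj (pe i b) y ->
  [\/ y = px m,
      i < m + b /\ y \in pn i b
    | exists j b', [/\ j <= m.+1, y = pe j b', (j == i.+1) || (i == j.+1)
                     & [|| b == b', i == m.+1 | j == m.+1]]].
Proof.
move=> im xy; have xy' := adj_edge xy.
case: (pvertexP y) xy xy' => {y} [j jm|j b' jm|j b' y jm yN] xy xy'.
- constructor 1; move: jm; rewrite leq_eqVlt => /predU1P[-> //|jm].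
  by move: xy; rewrite adj_sym => /(adj_px jm); rewrite !pe_pn => -[].
- constructor 3; exists j, b'.
  by have /andP[] := ge_edge_inv im jm xy'.
constructor 2; have jm' := lt_heavy jm.
have := pnew_edge yN; rewrite sedge_sym in xy'; move/(_ _ xy').
rewrite pe_pn !inl_paste_eq ge_eq //; last lia.
have -> /= : (ge i b == gx j) = false by [].
have jz : (i == j) && (i == m.+1) = false by lia.
by rewrite andb_orr jz orbF => /andP[/eqP-> /eqP->].
Qed.
End MissingOne.

Lemma pn_adj c i b x y : graph_cycle c -> x \in pn i b -> cyc_adj c x y -> y \in pK i b.
Proof.
move=> cc xN /(adj_edge cc)/(pnew_edge xN); rewrite 2!in_setU1.
by case/or3P=> ->; rewrite ?orbT.
Qed.

(* The neighbours of [pe 0 b] and [pe 1 b] outside the pasted cliques are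
   forced to be each other, so the vertices of level at most 1 are closed. *)
Lemma no_cycle_missing_z (c : seq P) : graph_cycle c ->
  [set:: c] <> [set~ pe m.+1 true].
Proof.
move=> cc cS; have mem_c x : (x \in c) = (x != pe m.+1 true).
  by have /setP/(_ x) := cS; rewrite in_setC1 inE.
have [/andP[szc /andP[_ uniq_c]] bad] := (cc, or_intror (erefl _) :
  pe m.+1 true = pe m false \/ pe m.+1 true = pe m.+1 true).
have vc : pe m false \in c by rewrite mem_c inl_paste_eq ge_eq //; lia.
have v_adj y : cyc_adj c (pe m false) y -> y = px m \/ y = pe m.-1 false.
  move=> vy; case: (adj_pe cc mem_c bad (leqnSn m) vy) => [->|[]|]; [by left|lia|].
  case=> j [b' [jm yE jE bE]]; right; move: (adj_neq_bad mem_c vy).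
  rewrite yE inl_paste_eq ge_eq // => jz; apply/eqP.
  by rewrite inl_paste_eq ge_eq //; case: b' {yE} jz bE; lia.
(* Only two candidates are left for the two neighbours of v_k, so both are used. *)
have v_x : cyc_adj c (px m) (pe m false).
  have [y1 [y2 [vy1 vy2 y12]]] := cyc_adj2 uniq_c szc vc.
  rewrite cyc_adj_sym //; case: (v_adj _ vy1) (v_adj _ vy2) => y1E [] y2E.
  - by rewrite -y1E.
  - by rewrite -y1E.
  - by rewrite -y2E.
  - by rewrite y1E y2E eqxx in y12.
have m1 : m < m + true by rewrite addn1.
have [[q qN xq] _] := heavy_adj cc mem_c bad m1 (mem_head _ _).
(* The edges to v_k and into the clique on x_k u_k saturate x_k. *)
have x_adj i b : i < m -> ~ cyc_adj c (pe i b) (px m).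
  have qv : q != pe m false by rewrite (pn_inl _ qN).
  move=> im; rewrite cyc_adj_sym // => /(cyc_adj_inv xq v_x qv)[] /eqP.
    by rewrite eq_sym (pn_inl _ qN).
  by rewrite inl_paste_eq ge_eq ?(leqW (ltnW im)) // ltn_eqF.
(* The ends of the path need a neighbour outside their clique. With x_k excluded, only level 1 on
   the same side is left; it is not z since [m] is positive. *)
have e01 b : cyc_adj c (pe 0 b) (pe 1 b).
  have m0 : 0 < m + b := ltn_addr _ (ltnW m_ge2).
  have g2 : ge 0 b \in [:: gx 0; ge 0 b] by rewrite !inE eqxx orbT.
  have [_ [y yK ey]] := heavy_adj cc mem_c bad m0 g2.
  case: (adj_pe cc mem_c bad (leq0n _) ey) => [yE|[_ yN]|].
  - by rewrite yE in ey; case: (@x_adj 0 b (ltnW m_ge2)).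
  - by rewrite 2!in_setU1 yN !orbT in yK.
  case=> j [b' [jm yE jE bE]]; move: ey; rewrite yE.
  have j1 : j = 1 by move: jE; rewrite orbF => /eqP.
  by move: bE; rewrite j1 /= eqSS [0 == m]ltn_eqF ?(ltnW m_ge2) // orbF => /eqP->.
have clS : forall y z, y \in [set x | lev x <= 1] -> cyc_adj c y z ->
    z \in [set x | lev x <= 1].
  move=> y z; rewrite !in_set; case: (pvertexP y) => {y} [i im|i b im|i b y im yN].
  - rewrite lev_px // => i1 xz.
    have im' := leq_ltn_trans i1 m_ge2.
    by case: (adj_px cc mem_c bad im' xz) => /lev_pn ->.
  - rewrite lev_pe // => i1 ez; have im' : i < m + b := ltn_addr _ (leq_ltn_trans i1 m_ge2).
    have g2 : ge i b \in [:: gx i; ge i b] by rewrite !inE eqxx orbT.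
    have [[q' qN' eq'] _] := heavy_adj cc mem_c bad im' g2.
    (* For [i <= 1], [1 - i] is the other of the levels 0 and 1. *)
    have e10 : cyc_adj c (pe i b) (pe (1 - i) b).
      by case: i i1 {im ez im' g2 qN' eq'} => [|[|//]] _; rewrite // cyc_adj_sym.
    have qe : q' != pe (1 - i) b by rewrite (pn_inl _ qN').
    case: (cyc_adj_inv eq' e10 qe ez) => ->.
      by rewrite (lev_pn _ qN') ?(lt_heavy im').
    have l1 : 1 - i <= m.+1 := leq_trans (leq_subr _ _) (ltn0Sn m).
    by rewrite lev_pe // leq_subr.
  - have im' := lt_heavy im; rewrite (lev_pn _ yN) // => i1 /(pn_adj cc yN).
    by move/lev_pK ->.
have p0 : px 0 \in [set x | lev x <= 1] by rewrite in_set lev_px.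
have := cyc_adj_closed uniq_c p0 (px_c mem_c bad 0) clS.
(* The cycle contains x_k, whose level [m] exceeds 1 exactly because k is at least 3. *)
by move/(_ _ (px_c mem_c bad m)); rewrite in_set lev_px // leqNgt m_ge2.
Qed.

(** Without v_k, the only neighbours left for z are x_k and u_k. Each of these has its other cycle
    edge into the clique on x_k u_k, so that clique together with z is closed, yet it omits x_1. *)
Lemma no_cycle_missing_v (c : seq P) : graph_cycle c ->
  [set:: c] <> [set~ pe m false].
Proof.
move=> cc cS; have mem_c x : (x \in c) = (x != pe m false).
  by have /setP/(_ x) := cS; rewrite in_setC1 inE.
have [/andP[szc /andP[_ uniq_c]] bad] := (cc, or_introl (erefl _) :
  pe m false = pe m false \/ pe m false = pe m.+1 true).
pose z := pe m.+1 true.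
have zc : z \in c by rewrite mem_c inl_paste_eq ge_eq //; lia.
have z_adj y : cyc_adj c z y -> y = px m \/ y = pe m true.
  move=> zy; case: (adj_pe cc mem_c bad (leqnn _) zy) => [->|[]|]; [by left|lia|].
  case=> j [b' [jm yE jE bE]]; right; move: (adj_neq_bad mem_c zy).
  rewrite yE inl_paste_eq ge_eq // => jz; apply/eqP.
  by rewrite inl_paste_eq ge_eq //; case: b' {yE} jz bE; lia.
have [z_x z_u] : cyc_adj c z (px m) /\ cyc_adj c z (pe m true).
  have [y1 [y2 [zy1 zy2]]] := cyc_adj2 uniq_c szc zc.
  by case: (z_adj _ zy1) (z_adj _ zy2) => y1E [] y2E;
    move: zy1 zy2; rewrite y1E y2E ?eqxx.
have m1 : m < m + true by rewrite addn1.
have nbr d y : d \in [:: gx m; ge m true] -> cyc_adj c z (inl d) ->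
    cyc_adj c (inl d) y -> y \in z |: pK m true.
  move=> d2 zd dy; have [[q qN dq] _] := heavy_adj cc mem_c bad m1 d2.
  rewrite cyc_adj_sym // in zd.
  have qz : q != z by rewrite (pn_inl _ qN).
  by case: (cyc_adj_inv dq zd qz dy) => ->; rewrite 3!in_setU1 ?eqxx ?qN ?orbT.
have clS : forall x y, x \in z |: pK m true -> cyc_adj c x y -> y \in z |: pK m true.
  move=> x y /setU1P[->|/setU1P[->|/setU1P[->|xN]]].
  - by case/z_adj=> ->; rewrite in_setU1 (px_pK, pe_pK) ?eqxx ?orbT.
  - by apply: nbr; rewrite // !inE eqxx orbT.
  - by apply: nbr; rewrite // !inE eqxx.
  - by move/(pn_adj cc xN); rewrite in_setU1 => ->; rewrite orbT.
have := cyc_adj_closed uniq_c (setU11 _ _) zc clS.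
move/(_ _ (px_c mem_c bad 0)); by rewrite in_setU1 px_pe px_pK // ltn_eqF // ltnW.
Qed.

Lemma paste_not_cycle_extendible : ~ cycle_extendible P.
Proof.
have [c [cc cS]] := paste_cycle_missing_v_z.
have zv : pe m false != pe m.+1 true by rewrite inl_paste_eq ge_eq //; lia.
case/(_ c cc).
  rewrite /hamiltonian_cycle cc cS; apply/eqP => /setP/(_ (pe m false)).
  by rewrite in_setC in_set2 eqxx in_setT.
move=> c' [cc' sub card]; rewrite cS in sub card.
(* An extension has one vertex more than [c], which misses two, so it misses exactly one of v_k and
   z. *)
have : #|~: [set:: c']| = 1.
  have := cardsC [set:: c']; have := cardsC [set pe m false; pe m.+1 true].
  by rewrite cards2 zv card; lia.
move/eqP/cards1P=> [y yE].
have : y \in [set pe m false; pe m.+1 true].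
  move: sub; rewrite -setCS setCK yE => /subsetP; apply; exact: set11.
have cE : [set:: c'] = [set~ y] by rewrite -[LHS]setCK yE.
rewrite in_set2 => /orP[] /eqP yE'; rewrite yE' in cE.
  exact: no_cycle_missing_v cc' cE.
exact: no_cycle_missing_z cc' cE.
Qed.
End FamilyH.

(** * Invariance under isomorphism *)

Lemma graph_cycle_map (G H : sgraph) (f : G -> H) (c : seq G) : injective f ->
  (forall x y, sedge (f x) (f y) = sedge x y) ->
  graph_cycle (map f c) = graph_cycle c.
Proof.
move=> f_inj f_e; rewrite /graph_cycle /ucycleb size_map map_inj_uniq //.
by rewrite cycle_map (eq_cycle (e' := @sedge G)).
Qed.

Lemma set_of_map (G H : finType) (f : G -> H) (c : seq G) :
  [set:: map f c] = f @: [set:: c].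
Proof.
apply/setP=> y; rewrite inE; apply/mapP/imsetP => -[x xc ->];
  by exists x; rewrite // inE in xc *.
Qed.

Lemma isomorphic_sym (G H : sgraph) : isomorphic G H -> isomorphic H G.
Proof.
case=> f [g fK gK] f_e; exists g; first by exists f.
by move=> x y; rewrite -f_e !gK.
Qed.

Lemma hamiltonian_cycle_map (G H : sgraph) (f : G -> H) (c : seq G) : bijective f ->
  (forall x y, sedge (f x) (f y) = sedge x y) ->
  hamiltonian_cycle (map f c) = hamiltonian_cycle c.
Proof.
move=> f_bij f_e; have f_inj := bij_inj f_bij.
rewrite /hamiltonian_cycle graph_cycle_map // set_of_map; congr (_ && _).
have fT : f @: [set: G] = [set: H].
  case: f_bij => g _ gK; apply/setP=> y; rewrite in_setT -[y]gK.
  by rewrite imset_f ?in_setT.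
by rewrite -fT (inj_eq (imset_inj f_inj)).
Qed.

Lemma hamiltonian_iso (G H : sgraph) : isomorphic G H -> hamiltonian G -> hamiltonian H.
Proof.
case=> f f_bij f_e [c cH]; exists (map f c); by rewrite hamiltonian_cycle_map.
Qed.

Lemma cycle_extendible_iso (G H : sgraph) :
  isomorphic G H -> cycle_extendible G -> cycle_extendible H.
Proof.
case/isomorphic_sym=> g g_bij g_e extG c cc nham.
have g_inj := bij_inj g_bij; have [f gK fK] := g_bij.
have [|| c' [cc' sub card]] := extG (map g c).
- by rewrite graph_cycle_map.
- by rewrite hamiltonian_cycle_map.
have c'E : c' = map g (map f c') by rewrite mapK.
rewrite c'E in cc' sub card; exists (map f c'); split.
- by rewrite graph_cycle_map in cc'.
- apply/subsetP=> x; rewrite inE => xc; have := subsetP sub (g x).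
  by rewrite !inE !(mem_map g_inj); apply.
- by move: card; rewrite !(set_of_map g) !card_imset.
Qed.

Theorem theorem2p7 (k : nat) (hk : 3 <= k) (H : sgraph) (hH : familyH k H) :
  hamiltonian H /\ ~ cycle_extendible H.
Proof.
(* Writing k as [m.+1] turns the bound on k into [1 < m]. *)
case: k hk hH => // m m_ge2 [r r_ge3 isoH]; split.
  exact: hamiltonian_iso (isomorphic_sym isoH) (paste_hamiltonian r m_ge2).
by move/(cycle_extendible_iso isoH); apply: paste_not_cycle_extendible.
Qed.
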